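(* Let $n$ be a positive integer and $\mathbf b=(b_1,\dots,b_n)\in\mathbb Z_{>0}^n$. Then $\dim(\mathfrak X_n(\mathbf b))=n$, unless $n=1=b_1$, in which case $\dim(\mathfrak X_n(\mathbf b))=0$.
   Context: A $\mathbf b$-parking function is a list $(\beta_1,\dots,\beta_n)$ of positive integers whose nondecreasing rearrangement $\beta'_1\le\cdots\le\beta'_n$ satisfies $\beta'_i\le b_1+\cdots+b_i$ for all $1\le i\le n$. The $\mathbf b$-parking-function polytope $\mathfrak X_n(\mathbf b)\subset\mathbb R^n$ is the convex hull of all $\mathbf b$-parking functions. The dimension of a polytope is the dimension of its affine hull. *)

(* Defs.v *)
From HB Require Import structures.
From mathcomp Require Import all_boot all_order all_algebra.
From mathcomp Require Import boolp classical_sets reals convex.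

Set Implicit Arguments.
Unset Strict Implicit.
Unset Printing Implicit Defensive.

Import Order.TTheory GRing.Theory Num.Theory.

Local Open Scope classical_set_scope.
Local Open Scope ring_scope.

Section Hulls.
Variables (R : realType) (V : vectType R).
Implicit Types (A : set V) (U W : {vspace V}).

Definition convex_hull A : set V := smallest (@convex_set R V) A.

Definition affine_set A : Prop :=
  forall (x y : V) (t : R), A x -> A y -> A ((1 - t) *: x + t *: y).

Definition affine_hull A : set V := smallest affine_set A.

Definition flat (x : V) U : set V := [set v | v - x \in U].

(* A relation and not a function, so that no default value is needed for the
   empty set, which has no dimension here; see [polytope_dim_inj]. *)
Definition polytope_dim A (d : nat) : Prop :=
  exists x U, affine_hull A = flat x U /\ \dim U = d.

Lemma flat_affine x U : affine_set (flat x U).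
Proof.
move=> y z t; rewrite /flat /= => yU zU.
suff -> : (1 - t) *: y + t *: z - x = (1 - t) *: (y - x) + t *: (z - x).
  by rewrite memvD // memvZ.
by rewrite !scalerBr addrACA -opprD -scalerDl subrK scale1r.
Qed.

Lemma flat_inj x y U W : flat x U = flat y W -> U = W.
Proof.
move=> e.
have E v : (v - x \in U) = (v - y \in W).
  by apply/idP/idP => h; have := congr1 (fun S : set V => S v) e;
     rewrite /flat /= => q; [rewrite -q|rewrite q].
have xW : x - y \in W by rewrite -E subrr mem0v.
apply/vspaceP => u.
by have := E (u + x); rewrite addrK -addrA rpredDr.
Qed.

Lemma polytope_dim_inj A d e : polytope_dim A d -> polytope_dim A e -> d = e.
Proof.
by move=> [x [U [Ax <-]]] [y [W [Ay <-]]]; rewrite (flat_inj (etrans (esym Ax) Ay)).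
Qed.

End Hulls.

Section ParkingFunctions.
Variables (n : nat) (b : n.-tuple nat).

Definition parking_function (beta : n.-tuple nat) : Prop :=
  (forall i, (0 < tnth beta i)%N) /\
  (forall i : 'I_n, (tnth [tuple of sort leq beta] i <=
                     \sum_(j < n | (j <= i)%N) tnth b j)%N).

Definition parking_polytope (R : realType) : set 'rV[R]_n :=
  convex_hull [set \row_i (tnth beta i)%:R | beta in parking_function].

End ParkingFunctions.

(* Otherwise R is implicit, as the set type unfolds to a function type. *)
Arguments parking_polytope {n} b R _.

(* Main.v *)
(* Write p for the all-ones vector and e_i for the unit vectors.  Outside the
   case n = 1 = b_1 the total b_1 + ... + b_n is at least 2, so that p and all
   the p + e_i are parking functions; an affine set containing these n + 1
   affinely independent points is the whole space.  When n = 1 = b_1 the only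
   parking function is p. *)
Require Import Defs.
From mathcomp Require Import all_boot all_order all_algebra.
From mathcomp Require Import reals.
From mathcomp Require Import classical_sets convex ring zify.

Import Order.TTheory GRing.Theory Num.Theory.

Section Hulls.
Local Open Scope classical_set_scope.
Local Open Scope ring_scope.
Context {R : realType}.

(** Translated by [- p], the set [A] contains 0 and is closed under scaling ([AZ]) and addition
    ([AD]). It is thus a linear subspace, and it contains every unit vector. *)
Lemma affine_full {n : nat} (A : set 'rV[R]_n) (p : 'rV[R]_n) :
  affine_set A -> A p -> (forall i, A (p + delta_mx 0 i)) -> A = setT.
Proof.
move=> Aaff Ap Ae.
have AD u v : A (p + u) -> A (p + v) -> A (p + (u + v)).
  move=> Au Av.
  (* Take the midpoint of [p + u] and [p + v], then dilate from [p] by the factor 2. *)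
  have -> : p + (u + v) = (1 - 2) *: p
      + 2 *: ((1 - 2^-1) *: (p + u) + 2^-1 *: (p + v)).
    by apply/rowP => j; rewrite !mxE; field.
  exact: (Aaff _ _ _ Ap (Aaff _ _ _ Au Av)).
have AZ t u : A (p + u) -> A (p + t *: u).
  move=> Au; have -> : p + t *: u = (1 - t) *: p + t *: (p + u).
    by apply/rowP => j; rewrite !mxE; ring.
  exact: (Aaff _ _ _ Ap Au).
rewrite -subTset => v _.
rewrite -[v](subrKC p) [v - p]row_sum_delta.
elim/big_ind: _ => [|//|i _]; first by rewrite addr0.
exact: AZ.
Qed.

Lemma affine_hull_affine {V : vectType R} (A : set V) : affine_set (affine_hull A).
Proof.
by move=> x y t Ax Ay B BP; case: (BP) => Baff _; apply: Baff; [apply: Ax|apply: Ay].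
Qed.

Lemma convex_hull1 {V : vectType R} (x : V) : convex_hull [set x] = [set x].
Proof.
apply: smallest_id => y z t; rewrite !inE => -> ->.
exact: (convmm t (x : convex_lmodType V)).
Qed.

Lemma affine_hull1 {V : vectType R} (x : V) : affine_hull [set x] = [set x].
Proof.
by apply: smallest_id => y z t -> ->; rewrite /= -scalerDl subrK scale1r.
Qed.

Lemma polytope_dim1 {V : vectType R} (x : V) : polytope_dim [set x] 0.
Proof.
exists x, 0%VS; split; last exact: dimv0.
rewrite affine_hull1; apply/seteqP; split=> y /=; rewrite /flat /= memv0 subr_eq0.
  by move=> ->.
by move/eqP.
Qed.

End Hulls.

Section Parking.
Context {n : nat} (b : n.-tuple nat).
Hypothesis b_gt0 : forall i : 'I_n, 0 < tnth b i.

(** Indices start at 0, so the sum has [i + 1] terms, each at least 1. *)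
Lemma ltn_partial_sum (i : 'I_n) : i < \sum_(j < n | j <= i) tnth b j.
Proof.
have : \sum_(j < n | j <= i) 1 <= \sum_(j < n | j <= i) tnth b j by exact: leq_sum.
apply: leq_trans.
have /= <- := big_ord_widen n (fun=> 1) (ltn_ord i).
by rewrite sum1_card card_ord.
Qed.

Lemma parking_function_ones : parking_function b [tuple of nseq n 1].
Proof.
split=> i; first by rewrite tnth_nseq.
have : tnth [tuple of sort leq [tuple of nseq n 1]] i \in nseq n 1.
  by rewrite -(mem_sort leq) mem_tnth.
by move=> /nseqP[-> _]; apply: leq_ltn_trans (ltn_partial_sum i).
Qed.

(* Entries are at most 2 and b_1 + ... + b_(i+1) is at least i + 1, so the
   only constraint that could fail is the one at i = 0, on the minimum. *)
Lemma parking_function_ones_succ (k : 'I_n) :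
  (n = 1 -> tnth b k != 1) ->
  parking_function b [tuple (i == k).+1 | i < n].
Proof.
move=> n1; split=> i; first by rewrite tnth_mktuple.
set beta := [tuple (i == k).+1 | i < n].
set s := [tuple of sort leq beta].
have s_mem j : tnth s j \in beta by rewrite -(mem_sort leq) mem_tnth.
have s_le2 j : tnth s j <= 2.
  by have /tnthP[l ->] := s_mem j; rewrite tnth_mktuple; case: eqP.
have [i0|i_gt0] := posnP i; last first.
  by apply: leq_trans (s_le2 i) _; apply: leq_ltn_trans i_gt0 (ltn_partial_sum i).
(* At [i = 0] the bound is [b_1]. If [n = 1], the only entry is 2 and the hypothesis gives
   [b_1 >= 2]; otherwise some entry away from [k] equals 1. *)
have [n_eq1|n_neq1] := eqVneq n 1.
  apply: leq_trans (s_le2 i) _.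
  have ik : i = k by apply: ord_inj; have := ltn_ord k; lia.
  rewrite (bigD1 i) //= ik; apply: leq_trans (leq_addr _ _).
  by rewrite ltn_neqAle eq_sym n1 // b_gt0.
have [l lk] : exists l : 'I_n, l != k.
  have n_gt1 : 1 < n by have := ltn_ord k; lia.
  have [ki|] := eqVneq i k; last by exists i.
  by exists (Ordinal n_gt1); rewrite -ki -val_eqE /= i0.
have /tnthP[m m1] : 1 \in s.
  rewrite mem_sort; apply/tnthP; exists l.
  by rewrite tnth_mktuple (negPf lk).
(* The value 1 occurs at position [m] of the sorted tuple, and position [i = 0] comes no later, so
   its entry is at most 1. *)
apply: (@leq_trans 1); last by apply: leq_ltn_trans (ltn_partial_sum i).
rewrite [leqRHS]m1 !(tnth_nth 0); apply: (sorted_leq_nth leq_trans leqnn).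
- exact: (sort_sorted leq_total).
- by rewrite inE size_tuple.
- by rewrite inE size_tuple.
- by rewrite i0.
Qed.

End Parking.

Theorem proposition2p2 (R : realType) (n : nat) (b : n.-tuple nat)
    (n_gt0 : (0 < n)%N) (b_gt0 : forall i : 'I_n, (0 < tnth b i)%N) :
  (~ (n = 1%N /\ nth 0%N b 0 = 1%N) -> polytope_dim (parking_polytope b R) n) /\
  (n = 1%N /\ nth 0%N b 0 = 1%N -> polytope_dim (parking_polytope b R) 0%N).
Proof.
split=> [nb|[n1 b1]].
  set p : 'rV[R]_n := const_mx 1%R.
  have hull_pf beta : parking_function b beta ->
      affine_hull (parking_polytope b R) (\row_i (tnth beta i)%:R)%R.
    (* A generator lies in its convex hull, and that hull lies in its affine hull. *)
    by move=> beta_pf; do 2! apply: sub_gen_smallest; exists beta.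
  exists p, fullv; split; last by rewrite dimvf /dim /= mul1n.
  rewrite (@affine_full R n _ p (affine_hull_affine _)).
  - by apply/seteqP; split=> // v _; rewrite /flat /= memvf.
  - have := hull_pf _ (parking_function_ones b b_gt0).
    by congr (affine_hull _ _); apply/rowP => j; rewrite !mxE tnth_nseq.
  - move=> k; have /hull_pf : parking_function b [tuple (i == k).+1 | i < n].
      apply: parking_function_ones_succ => // n1; apply/eqP => bk; apply: nb.
      split=> //; rewrite -bk (tnth_nth 0); congr nth.
      by have := ltn_ord k; lia.
    congr (affine_hull _ _); apply/rowP => j.
    by rewrite !mxE tnth_mktuple -natr1 addrC.
subst n; rewrite /parking_polytope.
suff -> : [set \row_i (tnth beta i)%:R | beta in parking_function b]%R%classic
    = [set const_mx 1%R]%classic :> set 'rV[R]_1.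
  by rewrite convex_hull1; exact: polytope_dim1.
apply/seteqP; split=> [_ [beta [beta_gt0 beta_le] <-]|_ ->] /=.
  apply/rowP => j; rewrite !mxE (ord1 j).
  have := beta_le ord0; rewrite big_mkcond big_ord1 /=.
  have -> : tnth b ord0 = 1 by rewrite (tnth_nth 0).
  (* Sorting a one-entry tuple changes nothing, so the entry is positive and at most [b_1 = 1]. *)
  have : tnth [tuple of sort leq beta] ord0 = tnth beta ord0.
    have : tnth beta ord0 \in [tuple of sort leq beta] by rewrite mem_sort mem_tnth.
    by move=> /tnthP[l ->]; rewrite (ord1 l).
  by move=> ->; have := beta_gt0 ord0; case: (tnth beta ord0) => [|[]].
exists [tuple of nseq 1 1]; first exact: parking_function_ones.
by apply/rowP => j; rewrite !mxE tnth_nseq.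
Qed.
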